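(* Let $0<|q|<1$, $c\in\mathbb{C}\setminus\{0\}$ and $d\in\mathbb{C}$ with $|d|<1$. Then \[ \sum_{i,j,k\geq0}\frac{(-1)^{i}c^{2i-j+2k}d^{j}q^{(i^{2}+(i-j+2k)^{2}-2i+j-2k)/2}}{(q;q)_{i}(q;q)_{j}(q^{2};q^{2})_{k}}=\frac{(-d q/c;q)_{\infty}(c^{2};q^{2})_{\infty}}{(d^{2};q^{2})_{\infty}}. \]
   Context: For $a\in\mathbb{C}$ and $|p|<1$: $(a;p)_0=1$, $(a;p)_n=\prod_{k=0}^{n-1}(1-ap^k)$, $(a;p)_\infty=\prod_{k\ge0}(1-ap^k)$. *)

(* Defs.v *)
From HB Require Import structures.
From mathcomp Require Import all_boot all_order all_algebra.
From mathcomp Require Import ring zify finmap.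
From mathcomp Require Import boolp classical_sets reals topology normedtype.
From mathcomp Require Import complex.
From mathcomp Require Import showcase.summability.

Set Implicit Arguments.
Unset Strict Implicit.
Unset Printing Implicit Defensive.

Import Order.TTheory GRing.Theory Num.Theory numFieldNormedType.Exports.

Local Open Scope classical_set_scope.
Local Open Scope ring_scope.

Definition qpoch (K : pzRingType) (a p : K) (n : nat) : K :=
  \prod_(0 <= k < n) (1 - a * p ^+ k).

(* [lim] is a default value when the partial products diverge; for
   [`|p| < 1] in the complex numbers they converge. *)
Definition qpoch_inf (K : numFieldType) (a p : K) : K :=
  lim (qpoch a p n @[n --> \oo]).

(* Unconditional summability to [s]: the sums over finite sets of indices,
   directed by inclusion, converge to [s]. In the complex numbers this is
   absolute convergence together with the value of the sum.
   The definition is over an abstract [K] because [R[i]] carries its topology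
   only through its [numFieldType] structure. *)
Definition has_sum (I : choiceType) (K : numFieldType) (x : I -> K) (s : K) :
  Prop := partial_sum x @ totally --> s.

Definition qexp_num (i j k : nat) : int :=
  i%:Z ^+ 2 + (i%:Z - j%:Z + 2 * k%:Z) ^+ 2 - 2 * i%:Z + j%:Z - 2 * k%:Z.

Definition qexp (i j k : nat) : int := (qexp_num i j k %/ 2)%Z.

Lemma qexp_numE (i j k : nat) : qexp i j k * 2 = qexp_num i j k.
Proof.
have even_pred (x : int) : (2 %| x * (x - 1))%Z.
  rewrite (divz_eq x 2); set y := (x %/ 2)%Z; set r := (x %% 2)%Z.
  have -> : (y * 2 + r) * (y * 2 + r - 1)
            = y * (2 * y + 2 * r - 1) * 2 + r * (r - 1) by ring.
  apply: rpredD; first exact: dvdz_mull.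
  have : r = 0 \/ r = 1 by rewrite /r; lia.
  by case=> ->.
apply/divzK; set m := i%:Z - j%:Z + 2 * k%:Z.
have -> : qexp_num i j k = i%:Z * (i%:Z - 1) + m * (m - 1).
  by rewrite /qexp_num /m; ring.
by rewrite rpredD.
Qed.

(* Main.v *)
(* By Euler's expansions of (z;p)_oo and 1/(z;p)_oo, the right-hand side is also
   an absolutely convergent triple sum. The coefficients of c^(2N-j) d^j on the two
   sides are finite sums over i+k = N and over n+s = N, r+2s = j; up to a
   common factor they are the values at x = q^(-j) of the polynomials
     sum_(i+k=N) (-1)^i x^(i+2k) q^(C(i,2)+C(i+2k,2)) / ((q;q)_i (q^2;q^2)_k),
     sum_(n+s=N) (-1)^n q^(n(n-1)) (x;q)_(2s) / ((q^2;q^2)_n (q^2;q^2)_s).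
   Both satisfy F_N(x) - F_N(qx) = - x (1-qx) F_(N-1)(q^2 x), and F_N(0) = 0 for
   N > 0; as q is not a root of unity, this recurrence determines them. *)
Require Import Defs.
From HB Require Import structures.
From mathcomp Require Import all_boot all_order all_algebra.
From mathcomp Require Import finmap boolp classical_sets reals topology.
From mathcomp Require Import normedtype sequences.
From mathcomp Require Import complex.
From mathcomp Require Import ring lra zify.
From mathcomp Require Import showcase.summability.

Set Implicit Arguments.
Unset Strict Implicit.

Import Order.TTheory GRing.Theory Num.Theory numFieldNormedType.Exports.

Local Open Scope classical_set_scope.
Local Open Scope ring_scope.
Local Open Scope complex_scope.

(** * Finite q-Pochhammer symbols *)

Lemma qpoch0 (K : pzRingType) (a p : K) : qpoch a p 0 = 1.
Proof. by rewrite /qpoch big_geq. Qed.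

Lemma qpochS (K : pzRingType) (a p : K) n :
  qpoch a p n.+1 = qpoch a p n * (1 - a * p ^+ n).
Proof. by rewrite /qpoch big_nat_recr. Qed.

Lemma qpochSl (K : pzRingType) (a p : K) n :
  qpoch a p n.+1 = (1 - a) * qpoch (a * p) p n.
Proof.
rewrite /qpoch big_nat_recl// expr0 mulr1; congr (_ * _).
by apply: eq_bigr => k _; rewrite exprS mulrA.
Qed.

Lemma qpoch_neq0 (F : fieldType) (p : F) :
  (forall n, p ^+ n.+1 != 1) -> forall n, qpoch p p n != 0.
Proof.
move=> pX1; elim=> [|n IH]; first by rewrite qpoch0 oner_neq0.
by rewrite qpochS mulf_neq0// -exprS subr_eq0 eq_sym pX1.
Qed.

(** * The polynomial identity behind the equality of coefficients *)

Section quadratic_transformation.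
Variables (F : fieldType) (q : F).
Hypothesis q0 : q != 0.
Hypothesis qX1 : forall n, q ^+ n.+1 != 1.

Local Notation P := (qpoch q q).
Local Notation P2 := (qpoch (q ^+ 2) (q ^+ 2)).

Let qpochq_neq0 : forall n, P n != 0 := qpoch_neq0 qX1.

Let qpochq2_neq0 n : P2 n != 0.
Proof.
apply: qpoch_neq0 => m; rewrite -exprM mulnS; exact: (qX1 (2 * m).+1).
Qed.

(* The coefficients of [c ^ (2N - j) * d ^+ j] on the two sides of the theorem
   are, up to a common factor, [lser N (q ^- j)] and [rser N (q ^- j)]. *)
Definition lser_coef (i k : nat) : F :=
  (-1) ^+ i * q ^+ ('C(i, 2) + 'C(i + 2 * k, 2)) / (P i * P2 k).

Definition lser (N : nat) (x : F) : F :=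
  \sum_(i < N.+1) lser_coef i (N - i) * x ^+ (i + 2 * (N - i)).

Definition rser_coef (n s : nat) : F :=
  (-1) ^+ n * (q ^+ 2) ^+ 'C(n, 2) / (P2 n * P2 s).

Definition rser (N : nat) (x : F) : F :=
  \sum_(s < N.+1) rser_coef (N - s) s * qpoch x q (2 * s).

(** With k = N+1-i, split 1 - q^(i+2k) as (1 - q^(2k)) + q^(2k) (1 - q^i). The first part cancels a
    factor of [P2 k] and yields x^2 q times [lser N (x * q ^+ 2)]; the second cancels a factor of
    [P i] and, after a shift of i, yields -x times the same value. *)
Lemma lser_rec N x :
  lser N.+1 x - lser N.+1 (x * q) = - (x * (1 - x * q) * lser N (x * q ^+ 2)).
Proof.
pose t i k := lser_coef i k * x ^+ (i + 2 * k).
have -> : lser N.+1 x - lser N.+1 (x * q)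
  = \sum_(i < N.+2) t i (N.+1 - i)%N * (1 - (q ^+ 2) ^+ (N.+1 - i)) +
    \sum_(i < N.+2) t i (N.+1 - i)%N * (q ^+ 2) ^+ (N.+1 - i) * (1 - q ^+ i).
  rewrite -big_split -sumrB; apply: eq_bigr => i _ /=.
  by rewrite /t exprMn !exprD expr0 expr2 exprMn; ring.
rewrite big_ord_recr /= subnn expr0 subrr mulr0 addr0.
rewrite [X in _ + X]big_ord_recl /= expr0 subrr mulr0 add0r.
rewrite /lser mulr_sumr -sumrN -big_split; apply: eq_bigr => i _ /=.
rewrite /bump /= add1n subSS subSn -1?ltnS//; set k := (N - i)%N.
rewrite /t /lser_coef qpochS qpochS.
have := qpochq_neq0 i; have := qpochq2_neq0 k.
have := qpochq_neq0 i.+1; have := qpochq2_neq0 k.+1; rewrite !qpochS.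
set a := P i; set b := P2 k => h1 h2 h3 h4.
have e1 : ('C(i, 2) + 'C(i + 2 * k.+1, 2) =
    ('C(i, 2) + 'C(i + 2 * k, 2)) + (i + i + k + k + k + k + 1))%N.
  by rewrite mulnS addnCA !binS !bin1 bin0; lia.
have e2 : ('C(i.+1, 2) + 'C(i.+1 + 2 * k, 2) =
    ('C(i, 2) + 'C(i + 2 * k, 2)) + (i + i + k + k))%N.
  by rewrite addSn !binS !bin1; lia.
rewrite e1 e2 [(i + 2 * k.+1)%N](_ : _ = i + k + k + 2)%N; last lia.
rewrite [(i.+1 + 2 * k)%N](_ : _ = i + k + k + 1)%N; last lia.
rewrite [(i + 2 * k)%N](_ : _ = i + k + k)%N; last lia.
set g := ('C(i, 2) + _)%N; rewrite !(exprMn, exprD, exprS, expr0, mulr1).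
have {}h1 : 1 - q * q * (q ^+ k * q ^+ k) != 0.
  by move: h1; rewrite mulf_eq0 negb_or expr2 exprMn => /andP[].
have {}h2 : 1 - q * q ^+ i != 0 by move: h2; rewrite mulf_eq0 negb_or => /andP[].
by field; rewrite h1 h2 h3 h4.
Qed.

(** The symbols (x;q)_(2s+2) and (xq;q)_(2s+2) share the factor (xq;q)_(2s+1), so their difference
    is -x (1 - q^(2s+2)) (xq;q)_(2s+1), where 1 - q^(2s+2) cancels the last factor of [P2 s.+1]. The
    term s = 0 drops out. *)
Lemma rser_rec N x :
  rser N.+1 x - rser N.+1 (x * q) = - (x * (1 - x * q) * rser N (x * q ^+ 2)).
Proof.
rewrite /rser -sumrB big_ord_recl /= !muln0 !qpoch0 subrr add0r.
rewrite mulr_sumr -sumrN; apply: eq_bigr => i _ /=.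
rewrite /bump /= add1n subSS mulnS !(@qpochSl _ _ q).
rewrite -(@qpochSl _ (x * q * q)) (@qpochS _ (x * q * q)) -(mulrA x) -expr2.
rewrite /rser_coef qpochS.
have := qpochq2_neq0 i; have := qpochq2_neq0 (N - i).
have := qpochq2_neq0 i.+1; rewrite qpochS.
set a := P2 _; set b := P2 i; set t := qpoch _ _ _ => h1 h2 h3.
have {}h1 : 1 - q ^+ 2 * q ^+ 2 ^+ i != 0.
  by move: h1; rewrite mulf_eq0 negb_or => /andP[].
rewrite -(exprM _ 2) in h1 *.
by field; rewrite h1 h2 h3.
Qed.

Lemma lser0 N : lser N.+1 0 = 0.
Proof.
rewrite /lser big1// => i _; rewrite (_ : (i + _)%N = (i + 2 * (N.+1 - i)).-1.+1).
  by rewrite exprS mul0r mulr0.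
by have := ltn_ord i; lia.
Qed.

Lemma qpoch0l (p : F) n : qpoch 0 p n = 1.
Proof. by rewrite /qpoch big1// => i _; rewrite mul0r subr0. Qed.

(** With p = q^2, [rser M 0] is the coefficient of z^M in the product of Euler's expansions of
    (z;p)_oo and 1/(z;p)_oo. Splitting 1 - p^(M+1) as (1 - p^s) + p^s (1 - p^(M+1-s)) links
    consecutive coefficients, and 1 - p^0 = 0 starts the induction. *)
Lemma rser0 N : rser N.+1 0 = 0.
Proof.
pose p := q ^+ 2.
have r0 M : rser M 0 = \sum_(s < M.+1) rser_coef (M - s) s.
  by apply: eq_bigr => s _; rewrite qpoch0l mulr1.
have rec M : (1 - p ^+ M.+1) * rser M.+1 0 = (1 - p ^+ M) * rser M 0.
  have -> : (1 - p ^+ M.+1) * rser M.+1 0 =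
      \sum_(s < M.+2) (1 - p ^+ s) * rser_coef (M.+1 - s) s +
      \sum_(s < M.+2) p ^+ s * (1 - p ^+ (M.+1 - s)) * rser_coef (M.+1 - s) s.
    rewrite r0 mulr_sumr -big_split; apply: eq_bigr => s _ /=.
    have -> : p ^+ M.+1 = p ^+ s * p ^+ (M.+1 - s) by rewrite -exprD subnKC// leq_ord.
    by ring.
  rewrite big_ord_recl expr0 subrr mul0r add0r /=.
  rewrite [X in _ + X]big_ord_recr /= subnn expr0 subrr mulr0 mul0r addr0.
  rewrite r0 mulr_sumr -big_split; apply: eq_bigr => s _ /=.
  have sM : (s <= M)%N by rewrite -ltnS.
  rewrite /bump /= add1n subSS subSn//.
  have -> : p ^+ M = p ^+ s * p ^+ (M - s) by rewrite -exprD subnKC.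
  set n := (M - s)%N.
  rewrite /rser_coef !qpochS binS bin1 -/p.
  have := qpochq2_neq0 s; have := qpochq2_neq0 n.
  have := qpochq2_neq0 s.+1; have := qpochq2_neq0 n.+1; rewrite !qpochS -/p.
  set a := P2 n; set b := P2 s => h1 h2 h3 h4.
  have {}h1 : 1 - p * p ^+ n != 0 by move: h1; rewrite mulf_eq0 negb_or => /andP[].
  have {}h2 : 1 - p * p ^+ s != 0 by move: h2; rewrite mulf_eq0 negb_or => /andP[].
  rewrite !(exprD, exprS).
  by field; rewrite h1 h2 h3 h4.
have pS M : 1 - p ^+ M.+1 != 0 by rewrite -exprM mulnS subr_eq0 eq_sym (qX1 (2 * M).+1).
elim: N => [|N IH]; [apply: (mulfI (pS 0))|apply: (mulfI (pS N.+1))].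
  by rewrite rec expr0 subrr mul0r mulr0.
by rewrite rec IH !mulr0.
Qed.

Lemma horner_lser N : exists f : {poly F}, forall x, f.[x] = lser N x.
Proof.
exists (\sum_(i < N.+1) lser_coef i (N - i) *: 'X ^+ (i + 2 * (N - i))) => x.
by rewrite horner_sum; apply: eq_bigr => i _; rewrite !hornerE.
Qed.

Lemma horner_rser N : exists f : {poly F}, forall x, f.[x] = rser N x.
Proof.
exists (\sum_(s < N.+1) rser_coef (N - s) s *: qpoch 'X q%:P (2 * s)) => x.
rewrite horner_sum; apply: eq_bigr => i _; rewrite hornerZ /qpoch horner_prod.
by congr (_ * _); apply: eq_bigr => k _; rewrite !hornerE.
Qed.

(** The values at all powers of q equal f(1), and these powers are pairwise distinct since q is
    neither 0 nor a root of unity; so f - f(1) has at least as many roots as its size. *)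
Lemma horner_qdiff_const (f : {poly F}) :
  (forall x, f.[x] = f.[x * q]) -> forall x, f.[x] = f.[0].
Proof.
move=> fq x; suff -> : f = f.[1]%:P by rewrite !hornerC.
have fX n : f.[q ^+ n] = f.[1].
  by elim: n => [|n IH]; rewrite ?expr0// exprSr -fq.
have qXI : injective (GRing.exp q).
  have aux m k : q ^+ m != q ^+ (m + k.+1).
    rewrite exprD -[X in X != _]mulr1 (inj_eq (mulfI _)) ?expf_neq0//.
    by rewrite eq_sym qX1.
  move=> m n; case: (ltngtP m n) => // mn /eqP e.
    by have := aux m (n - m).-1; rewrite prednK ?subn_gt0// subnKC ?(ltnW mn)// e.
  by have := aux n (m - n).-1; rewrite prednK ?subn_gt0// subnKC ?(ltnW mn)// eq_sym e.
apply/eqP; rewrite -subr_eq0; apply/eqP.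
pose g := f - f.[1]%:P.
apply: (@roots_geq_poly_eq0 _ g (mkseq (GRing.exp q) (size g))).
- apply/allP => _ /mapP[n _ ->].
  by rewrite rootE !hornerE fX subrr.
- by rewrite mkseq_uniq.
- by rewrite size_mkseq.
Qed.

Theorem lser_rser N x : lser N x = rser N x.
Proof.
elim: N x => [|N IH] x.
  rewrite /lser /rser !big_ord1 /lser_coef /rser_coef subnn !muln0.
  by rewrite !qpoch0 addn0 !bin0n !expr0.
have [f fE] := horner_lser N.+1; have [g gE] := horner_rser N.+1.
apply/eqP; rewrite -subr_eq0 -fE -gE -hornerN -hornerD horner_qdiff_const.
  by rewrite !hornerE fE gE lser0 rser0 subrr.
move=> y; rewrite !hornerE !fE !gE; apply/eqP; rewrite -subr_eq0.
have e : lser N.+1 y - lser N.+1 (y * q) = rser N.+1 y - rser N.+1 (y * q).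
  by rewrite lser_rec rser_rec IH.
have -> (a b a' b' : F) : a - b - (a' - b') = a - a' - (b - b') by ring.
by rewrite e subrr.
Qed.

(** Reversal of (q^-j;q)_m: each factor 1 - q^(k-j) is -q^(k-j) (1 - q^(j-k)), and the factors 1 -
    q^(j-k) make up (q;q)_j / (q;q)_(j-m). *)
Lemma qpoch_invq j m : (m <= j)%N ->
  q ^+ 'C(j.+1, 2) * qpoch (q ^- j) q m * P (j - m) =
  (-1) ^+ m * q ^+ 'C((j - m).+1, 2) * P j.
Proof.
elim: m => [|m IH] mj; first by rewrite subn0 qpoch0 expr0; ring.
move: (IH (ltnW mj)); rewrite qpochS.
have -> : (j - m = (j - m.+1).+1)%N by lia.
rewrite qpochS binS bin1 exprD -exprS.
have -> : q ^- j * q ^+ m = (q ^+ (j - m.+1).+1)^-1.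
  have {1}-> : (j = m + (j - m.+1).+1)%N by lia.
  by rewrite exprD invfM mulrC mulrA mulfV ?mul1r ?expf_neq0.
set k := (j - m.+1)%N; rewrite (binS k.+1) bin1 exprD; set u := q ^+ k.+1 => e.
have u0 : u != 0 by rewrite expf_neq0.
apply: (mulfI u0); rewrite exprS; move: e.
set A := q ^+ 'C(j, 2) * _; set B := qpoch _ _ _; set D := P k.
set E := q ^+ 'C(_, 2); set G := P j; set S := (-1) ^+ m => e.
have -> : u * (-1 * S * E * G) = - (S * (E * u) * G) by ring.
by rewrite -e; field.
Qed.

(** The factor of index j is 1 - q^(-j) q^j = 0. This truncates [rser N (q ^- j)] to 2s <= j. *)
Lemma qpoch_invq_gt j m : (j < m)%N -> qpoch (q ^- j) q m = 0.
Proof.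
move=> jm; rewrite -(subnKC jm) /qpoch.
rewrite (@big_cat_nat _ _ _ j.+1) ?leq_addr//= big_nat_recr//=.
by rewrite mulVf ?expf_neq0// subrr mulr0 mul0r.
Qed.
End quadratic_transformation.

(** * Unconditional sums: linearity, grouping along finite fibres, products *)

Lemma sum_fsetM (V : nmodType) (I J : choiceType) (A : {fset I}) (B : {fset J})
    (F : I * J -> V) :
  \sum_(ij <- (A `*` B)%fset) F ij = \sum_(i <- A) \sum_(j <- B) F (i, j).
Proof.
rewrite -big_allpairs; apply: perm_big; apply: uniq_perm; first exact: fset_uniq.
  by apply: allpairs_uniq; rewrite ?fset_uniq// => -[? ?] [? ?].
move=> [a b]; rewrite in_fsetM /=.
apply/andP/allpairsP => [[aA bB]|[[? ?]/= [? ? [-> ->]]]]; last by split.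
by exists (a, b).
Qed.

Section has_sum.
Context {K : numFieldType}.
Implicit Types I J : choiceType.

Lemma partial_sumE I (x : I -> K) (A : {fset I}) :
  partial_sum x A = \sum_(i <- A) x i.
Proof. by rewrite /partial_sum big_seq_fsetE. Qed.

Lemma has_sumP I (x : I -> K) (s : K) :
  has_sum x s <-> forall e : K, 0 < e -> exists A : {fset I},
    forall B : {fset I}, (A `<=` B)%fset -> `|\sum_(i <- B) x i - s| < e.
Proof.
have FF := @totally_filter I.
rewrite /has_sum; split=> [/cvgrPdist_lt h e e0|h].
  have [A _ AB] := h _ e0; exists A => B /AB /=.
  by rewrite distrC partial_sumE.
apply/cvgrPdist_lt => e /h[A AB]; exists A => // B /AB.
by rewrite /= distrC partial_sumE.
Qed.

Lemma has_sum_unique I (x : I -> K) (s t : K) :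
  has_sum x s -> has_sum x t -> s = t.
Proof.
move=> hs ht; have FF := @totally_filter I.
by apply: cvg_unique hs ht; exact: norm_hausdorff.
Qed.

Lemma has_sumD I (x y : I -> K) (s t : K) :
  has_sum x s -> has_sum y t -> has_sum (fun i => x i + y i) (s + t).
Proof.
move=> /has_sumP hs /has_sumP ht; apply/has_sumP => e e0.
have e20 : 0 < e / 2 by rewrite divr_gt0.
have [A hA] := hs _ e20; have [B hB] := ht _ e20.
exists (A `|` B)%fset => C; rewrite fsubUset => /andP[/hA AC /hB BC].
rewrite big_split opprD addrACA (splitr e).
by rewrite (le_lt_trans (ler_normD _ _))// ltrD.
Qed.

Lemma has_sumZ I (a : K) (x : I -> K) (s : K) :
  has_sum x s -> has_sum (fun i => a * x i) (a * s).
Proof.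
move=> /has_sumP hs; apply/has_sumP => e e0.
have a0 : 0 < `|a| + 1 by rewrite ltr_wpDl.
have /hs[A hA] : 0 < e / (`|a| + 1) by rewrite divr_gt0.
exists A => B /hA; rewrite ltr_pdivlMr// => h.
rewrite -mulr_sumr -mulrBr normrM (le_lt_trans _ h)// mulrC.
by rewrite ler_wpM2l// lerDl.
Qed.

(** Over a finite B the fibre sums add up to the sum of [x] over the preimage of B, a finite set
    that contains A as soon as B contains f(A). *)
Lemma has_sum_fiber I J (f : I -> J) (fib : J -> seq I) (x : I -> K) (s : K) :
  (forall j, uniq (fib j)) -> (forall i j, (i \in fib j) = (f i == j)) ->
  has_sum x s -> has_sum (fun j => \sum_(i <- fib j) x i) s.
Proof.
move=> fibU fibP /has_sumP hs; apply/has_sumP => e /hs[A hA].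
exists (f @` A)%fset => B AB.
pose C := seq_fset tt (flatten (map fib B)).
have memC i : (i \in C) = (f i \in B).
  rewrite seq_fsetE; apply/flatten_mapP/idP => [[j jB]|fB].
    by rewrite fibP => /eqP ->.
  by exists (f i) => //; rewrite fibP.
have -> : \sum_(j <- B) \sum_(i <- fib j) x i = \sum_(i <- C) x i.
  transitivity (\sum_(i <- C) \sum_(j <- B | f i == j) x i).
    rewrite (exchange_big_dep predT)//= big_seq [RHS]big_seq; apply: eq_bigr => j jB.
    rewrite -[RHS]big_filter; apply: perm_big; apply: uniq_perm => //.
      by rewrite filter_uniq// fset_uniq.
    move=> i; rewrite mem_filter fibP memC.
    by case: eqP => // ->; rewrite jB.
  rewrite big_seq [RHS]big_seq; apply: eq_bigr => i; rewrite memC => fiB.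
  rewrite -big_filter (eq_filter (a2 := pred1 (f i)));
    last by move=> j /=; rewrite eq_sym.
  by rewrite filter_pred1_uniq ?fset_uniq// big_seq1.
apply: hA; apply/fsubsetP => i iA; rewrite memC.
by apply: (fsubsetP AB); apply: in_imfset.
Qed.

(** Grouping along the successor map: the fibre over 0 is empty, the others are singletons. *)
Lemma has_sum_shift (x : nat -> K) (s : K) :
  x 0%N = 0 -> has_sum (fun n => x n.+1) s -> has_sum x s.
Proof.
move=> x0 hs.
pose fib n := if n is m.+1 then [:: m] else [::].
have := has_sum_fiber (f := S) (fib := fib) _ _ hs.
set y := (fun j => _); have -> : y = x.
  by apply/funext => -[|n]; rewrite /y ?big_nil ?big_seq1.
apply => [[]|i []]//= n; first by rewrite inE.
Qed.

(** Identifies the value of a double sum already known to exist. Each finite set of pairs is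
    replaced by the rectangle on its two projections, where the sum factors; all three sums then
    converge along one filter. The points [i0] and [j0] lift finite subsets of I and J to sets of
    pairs. *)
Lemma has_sum_prod_eq I J (i0 : I) (j0 : J) (x : I -> K) (y : J -> K) (s t u : K) :
  has_sum x s -> has_sum y t -> has_sum (fun ij : I * J => x ij.1 * y ij.2) u ->
  u = s * t.
Proof.
move=> hs ht hu; have FF := @totally_filter (I * J)%type.
(* Cofinality: if [g B] contains any prescribed [A] for all large [B], the partial sums along [g]
   keep their limit. *)
have cof (L : choiceType) (g : {fset I * J} -> {fset L}) (z : L -> K) r :
    (forall A, exists A', forall B : {fset I * J},
      (A' `<=` B)%fset -> (A `<=` g B)%fset) ->
    has_sum z r -> partial_sum z \o g @ totally --> r.
  move=> gP hz U Ur; have [A _ AU] := hz U Ur; have [A' hA'] := gP A.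
  by exists A' => // B /hA' AB; exact: (AU _ AB).
pose g1 (C : {fset I * J}) := [fset z.1 | z in C]%fset.
pose g2 (C : {fset I * J}) := [fset z.2 | z in C]%fset.
have c1 : partial_sum x \o g1 @ totally --> s.
  apply: cof hs => A; exists [fset (a, j0) | a in A]%fset => B /fsubsetP AB.
  apply/fsubsetP => a aA; apply/imfsetP; exists (a, j0) => //.
  by apply: AB; apply/imfsetP; exists a.
have c2 : partial_sum y \o g2 @ totally --> t.
  apply: cof ht => A; exists [fset (i0, a) | a in A]%fset => B /fsubsetP AB.
  apply/fsubsetP => a aA; apply/imfsetP; exists (i0, a) => //.
  by apply: AB; apply/imfsetP; exists a.
pose g (C : {fset I * J}) := (g1 C `*` g2 C)%fset.
have c3 : partial_sum (fun ij : I * J => x ij.1 * y ij.2) \o g @ totally --> u.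
  apply: cof hu => A; exists A => B /fsubsetP AB.
  apply/fsubsetP => a /AB aB; rewrite in_fsetM; apply/andP; split; exact: in_imfset.
have gE : partial_sum (fun ij : I * J => x ij.1 * y ij.2) \o g =
    (partial_sum x \o g1) \* (partial_sum y \o g2).
  apply/funext => C; rewrite /= !partial_sumE /g.
  by rewrite big_distrlr sum_fsetM.
rewrite gE in c3.
have c4 := cvgM c1 c2.
exact: (cvg_unique (@norm_hausdorff K K) c3 (c4 _)).
Qed.

Lemma has_sum_norm_le I (x : I -> K) (s M : K) :
  has_sum x s -> (forall A : {fset I}, \sum_(i <- A) `|x i| <= M) -> `|s| <= M.
Proof.
move=> /has_sumP hs hM.
(* The order on [K] is partial; the empty sum gives M >= 0, so M is real and comparable with the
   norm of s. *)
have MR : M \is Num.real by apply: ger0_real; have := hM fset0; rewrite big_nil.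
have [//|Ms] := real_leP (normr_real s) MR.
have /hs[A /(_ _ (fsubset_refl A))] : 0 < `|s| - M by rewrite subr_gt0.
rewrite distrC ltrBrDr => h.
have : `|s| <= `|s - \sum_(i <- A) x i| + M.
  rewrite -{1}(subrK (\sum_(i <- A) x i) s) (le_trans (ler_normD _ _))// lerD2l.
  by rewrite (le_trans _ (hM A))// ler_norm_sum.
by move=> /le_lt_trans/(_ h); rewrite ltxx.
Qed.
End has_sum.

(** * Absolutely summable families *)

Section absolute_summability.
Context {K : numFieldType}.
Implicit Types I J : choiceType.

Definition abs_summable I (x : I -> K) :=
  exists M : K, forall A : {fset I}, \sum_(i <- A) `|x i| <= M.

Lemma ler_sum_fset I (F : I -> K) (A B : {fset I}) :
  (forall i, 0 <= F i) -> (A `<=` B)%fset ->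
  \sum_(i <- A) F i <= \sum_(i <- B) F i.
Proof.
move=> F0 AB; have -> : A = [fset i in B | i \in A]%fset.
  apply/fsetP => i; rewrite !inE /= andbC.
  by case: (boolP (i \in A)) => // /(fsubsetP AB).
rewrite -big_fset_condE big_mkcond; apply: ler_sum => i _.
by case: ifP.
Qed.

Lemma abs_summable_le I (x y : I -> K) (C : K) :
  (forall i, `|x i| <= C * `|y i|) -> 0 <= C -> abs_summable y -> abs_summable x.
Proof.
move=> xy C0 [M yM]; exists (C * M) => A.
rewrite (le_trans (ler_sum _ (fun i _ => xy i)))// -mulr_sumr.
by rewrite ler_wpM2l.
Qed.

Lemma abs_summable_prod I J (x : I -> K) (y : J -> K) :
  abs_summable x -> abs_summable y ->
  abs_summable (fun ij : I * J => x ij.1 * y ij.2).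
Proof.
move=> [M xM] [N yN]; exists (M * N) => C.
set A := [fset z.1 | z in C]%fset; set B := [fset z.2 | z in C]%fset.
apply: (@le_trans _ _ (\sum_(ij <- (A `*` B)%fset) `|x ij.1 * y ij.2|)).
  apply: ler_sum_fset => //; apply/fsubsetP => ij ijC.
  by rewrite in_fsetM; apply/andP; split; exact: in_imfset.
rewrite sum_fsetM /=; under eq_bigr do under eq_bigr do rewrite normrM.
by rewrite -big_distrlr /= ler_pM// sumr_ge0.
Qed.

Lemma abs_summable_geo (t : K) : `|t| < 1 -> abs_summable (fun n => t ^+ n).
Proof.
move=> t1; exists (1 - `|t|)^-1 => A.
pose N := (\max_(i <- A) i).+1; pose B := seq_fset tt (iota 0 N).
apply: (@le_trans _ _ (\sum_(i <- B) `|t ^+ i|)).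
  apply: ler_sum_fset => //; apply/fsubsetP => i iA.
  rewrite seq_fsetE mem_iota /= add0n ltnS.
  by apply: (@leq_bigmax_seq _ _ xpredT id).
rewrite (perm_big (iota 0 N)); last first.
  by apply: uniq_perm; rewrite ?fset_uniq ?iota_uniq// => i; rewrite seq_fsetE.
under eq_bigr do rewrite normrX.
rewrite -[N]subn0 -/(index_iota 0 N) big_mkord.
rewrite -[leRHS]mul1r ler_pdivlMr ?subr_gt0// mulrC -opprB mulNr -subrX1.
by rewrite opprB gerBl exprn_ge0.
Qed.
End absolute_summability.

(** * Absolute summability implies summability over the complex numbers *)

Section complex_has_sum.
Context {R : realType}.
Implicit Types I : choiceType.

Lemma bounded_has_sum_real I (x : I -> R) (M : R) :
  (forall i, 0 <= x i) -> (forall A : {fset I}, \sum_(i <- A) x i <= M) ->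
  exists s, has_sum x s.
Proof.
move=> x0 xM; pose E : set R := [set \sum_(i <- A) x i | A in [set: {fset I}]].
have hE : has_sup E.
  split; first by exists (\sum_(i <- fset0) x i), fset0.
  by exists M => _ [A _ <-].
exists (sup E); apply/has_sumP => e e0.
have [_ [A _ <-] hA] := sup_adherent e0 hE.
exists A => B /(ler_sum_fset x0) AB; rewrite ler0_norm.
  by rewrite opprB ltrBlDr -ltrBlDl (lt_le_trans hA AB).
by rewrite subr_le0; apply: ub_le_sup; [case: hE|exists B].
Qed.

Lemma norm_real_complex (x : R) : `|x%:C| = `|x|%:C.
Proof. by rewrite normc_def /= expr0n addr0 sqrtr_sqr. Qed.

(** Positivity in the order of [R[i]] includes being real, so every epsilon comes from R. *)
Lemma gt0_real_complex (e : R[i]) : 0 < e -> exists2 r : R, 0 < r & e = r%:C.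
Proof.
move=> e0; have eE : e = (complex.Re e)%:C by rewrite RRe_real// gtr0_real.
by exists (complex.Re e); rewrite // -ltcR -eE.
Qed.

Lemma has_sum_complex I (x : I -> R) (s : R) :
  has_sum x s -> has_sum (fun i => (x i)%:C) (s%:C).
Proof.
move=> /has_sumP hs; apply/has_sumP => e' e'0.
have [e e0 eE] := gt0_real_complex e'0; rewrite eE.
have [A hA] := hs _ e0; exists A => B /hA.
by rewrite -rmorph_sum -rmorphB norm_real_complex ltcR.
Qed.

(** Nonnegative real families with bounded sums are summable, so n = |x|, n + Re x and n + Im x have
    sums s0, s1, s2, and x has the sum s1 + i s2 - (1 + i) s0. *)
Lemma abs_summable_has_sum I (x : I -> R[i]) :
  abs_summable x -> exists s, has_sum x s.
Proof.
move=> [M xM]; pose n i := complex.Re `|x i|.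
have nE i : `|x i| = (n i)%:C by rewrite RRe_real ?normr_real.
have MR : M = (complex.Re M)%:C.
  by rewrite RRe_real// ger0_real//; have := xM fset0; rewrite big_nil.
have nM (A : {fset I}) : \sum_(i <- A) n i <= complex.Re M.
  have := xM A; rewrite (eq_bigr (fun i => (n i)%:C)) => [|i _]; last exact: nE.
  by rewrite -rmorph_sum MR lecR.
have shifted (r : I -> R) : (forall i, `|r i| <= n i) ->
    exists s, has_sum (fun i => (n i + r i)%:C) s.
  move=> rn.
  have [||s hs] :=
    @bounded_has_sum_real I (fun i => n i + r i) (complex.Re M *+ 2).
  - by move=> i; rewrite -lerBlDr sub0r (le_trans _ (rn i))// -normrN ler_norm.
  - move=> A; rewrite mulr2n big_split lerD//.
    by rewrite (le_trans _ (nM A))//; apply: ler_sum => i _;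
      apply: le_trans (rn i); exact: ler_norm.
  by exists (s%:C); exact: has_sum_complex.
have [|s0 h0] := shifted (fun=> 0).
  by move=> i; rewrite normr0 -lecR -nE; exact: normr_ge0.
have [|s1 h1] := shifted (fun i => complex.Re (x i)).
  by move=> i; rewrite -lecR -nE; exact: normc_ge_Re.
have [|s2 h2] := shifted (fun i => complex.Im (x i)).
  move=> i; rewrite -lecR -nE normc_def lecR -sqrtr_sqr ler_wsqrtr// lerDr sqr_ge0//.
exists (s1 + 'i%C * s2 + (- 1 - 'i%C) * s0).
have := has_sumD (has_sumD h1 (has_sumZ (a := 'i%C) h2)) (has_sumZ (a := - 1 - 'i%C) h0).
congr (has_sum _ _); apply/funext => i.
by rewrite addr0 [RHS]complexE !rmorphD; ring.
Qed.
End complex_has_sum.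

(** * Real bounds for (r;r)_n and for the Gaussian terms a^n r^(n(n-1)/2) *)

Section bounds.
Context {R : realType}.

Lemma expr_small (r e : R) : 0 <= r < 1 -> 0 < e -> exists n, r ^+ n < e.
Proof.
move=> /andP[r0 r1] e0; have : `|r| < 1 by rewrite ger0_norm.
move=> /cvg_expr /cvgrPdist_lt /(_ _ e0)[n _ /(_ n (leqnn n))].
by rewrite sub0r normrN ger0_norm ?exprn_ge0//; exists n.
Qed.

Lemma qpoch_gt0 (r : R) n : 0 <= r < 1 -> 0 < qpoch r r n.
Proof.
move=> /andP[r0 r1]; rewrite /qpoch prodr_gt0// => k _.
by rewrite subr_gt0 -exprS exprn_ilt1.
Qed.

Lemma qpoch_lbound (r : R) : 0 <= r < 1 ->
  exists2 m, 0 < m & forall n, m <= qpoch r r n.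
Proof.
move=> r01; have /andP[r0 r1] := r01.
(* With this k the sum of all r^(k+1+j) is below 1/2, so the factors beyond the k-th have a product
   of at least 1/2. *)
have [|k hk] := @expr_small r ((1 - r) / 2) r01; first by rewrite divr_gt0// subr_gt0.
exists (qpoch r r k / 2) => [|n]; first by rewrite divr_gt0// qpoch_gt0.
have P0 := qpoch_gt0 _ r01.
have anti i j : qpoch r r (i + j) <= qpoch r r i.
  elim: j => [|j IH]; first by rewrite addn0.
  rewrite addnS qpochS (le_trans _ IH)// ler_piMr ?(ltW (P0 _))// gerBl.
  by rewrite -exprS exprn_ge0.
have [nk|kn] := leqP n k.
  have := anti n (k - n)%N; rewrite subnKC// => h.
  by have := P0 k; lra.
rewrite -(subnKC (ltnW kn)).
(* Strengthening 1/2 to (1 + r^j)/2 makes the induction work: the decrease of r^j pays for each new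
   factor. *)
suff h j : qpoch r r k * ((1 + r ^+ j) / 2) <= qpoch r r (k + j).
  apply: le_trans (h _); rewrite ler_wpM2l ?(ltW (P0 _))//.
  by have := exprn_ge0 (n - k) r0; lra.
elim: j => [|j IH]; first by rewrite expr0 addn0; lra.
rewrite addnS qpochS.
apply: le_trans (ler_wpM2r _ IH); last first.
  by rewrite subr_ge0 -exprS exprn_ile1// ltW.
rewrite -mulrA ler_wpM2l ?(ltW (P0 _))//.
have : 0 <= r ^+ j <= 1 by rewrite exprn_ge0//= exprn_ile1// ltW.
have : 0 <= r ^+ k by rewrite exprn_ge0.
rewrite exprD exprS; set u := r ^+ j; set v := r ^+ k in hk * => v0 /andP[u0 u1].
have rv : r * v <= v by rewrite ler_piMl// ltW.
have rv0 : 0 <= r * v by rewrite mulr_ge0.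
have h : (1 + u) * (r * v) <= 1 - r by nra.
have : 0 <= u * (1 - r - (1 + u) * (r * v)) by rewrite mulr_ge0// subr_ge0.
by lra.
Qed.

(** Each term is a r^n times the one before, and a r^n <= 1 once r^n <= 1/(a+1); the terms no longer
    grow from index k on, and the sum of the first k+1 bounds them all. *)
Lemma gauss_bound_real (a r : R) : 0 <= a -> 0 <= r < 1 ->
  exists2 B, 0 <= B & forall n, a ^+ n * r ^+ 'C(n, 2) <= B.
Proof.
move=> a0 r01; have /andP[r0 r1] := r01.
have [|k hk] := @expr_small r (a + 1)^-1 r01; first by rewrite invr_gt0 ltr_wpDl.
pose u n := a ^+ n * r ^+ 'C(n, 2).
have u0 n : 0 <= u n by rewrite mulr_ge0// exprn_ge0.
exists (\sum_(i < k.+1) u i) => [|n]; first by rewrite sumr_ge0.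
have le_sum j : (j <= k)%N -> u j <= \sum_(i < k.+1) u i.
  rewrite -ltnS => jk; rewrite (bigD1 (Ordinal jk))//= lerDl sumr_ge0//.
have [nk|kn] := leqP n k; first exact: le_sum.
apply: le_trans (le_sum k (leqnn k)); rewrite -(subnKC (ltnW kn)).
elim: (n - k)%N => [|j IH]; first by rewrite addn0.
rewrite addnS (le_trans _ IH)// /u binS bin1 exprS (exprD r).
rewrite [leLHS](_ : _ = u (k + j)%N * (a * r ^+ (k + j))); last by rewrite /u; ring.
rewrite ler_piMr//.
have : r ^+ (k + j) <= (a + 1)^-1.
  by rewrite (le_trans _ (ltW hk))// exprD ler_piMr ?exprn_ge0// exprn_ile1// ltW.
move=> /(ler_wpM2l a0)/le_trans; apply.
by rewrite ler_pdivrMr ?mul1r ?lerDl// ltr_wpDl.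
Qed.
End bounds.

(** * Values of infinite products from functional equations *)

Section qpoch_inf.
Variables (K : numFieldType) (a p : K) (g : nat -> K) (s : K).
Hypothesis g1 : forall e : K, 0 < e ->
  exists N, forall n, (N <= n)%N -> `|g n - 1| < e.

Let cvg_g : g @ \oo --> (1 : K).
Proof.
apply/cvgrPdist_lt => e /g1[N hN]; exists N => // n /= Nn.
by rewrite distrC hN.
Qed.

(** In the application [g k] is the value at z p^k of a series with constant term 1. Once |g k - 1|
    < 1, [g k] is nonzero and the partial product is s / g k. *)
Lemma qpoch_inf_eq : (forall k, qpoch a p k * g k = s) -> qpoch_inf a p = s.
Proof.
move=> gs; apply: cvg_lim; first exact: norm_hausdorff.
have c : s * (g n)^-1 @[n --> \oo] --> s * 1^-1.
  apply: cvgM; first exact: cvg_cst.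
  by apply: cvgV => //; exact: oner_neq0.
rewrite invr1 mulr1 in c; apply: cvg_trans c; apply: near_eq_cvg.
have [N hN] := g1 ltr01; exists N => // n /= /hN gn.
rewrite -(gs n) mulfK//; apply: contraTneq gn => ->.
by rewrite sub0r normrN normr1 ltxx.
Qed.

(** Here s is nonzero automatically: s = 0 would make [g] vanish, against its limit 1. *)
Lemma qpoch_inf_eqV : (forall k, qpoch a p k * s = g k) -> qpoch_inf a p = s^-1.
Proof.
move=> gs; have s0 : s != 0.
  apply/eqP => s0; have [N /(_ N (leqnn N))] := g1 ltr01.
  by rewrite -gs s0 mulr0 sub0r normrN normr1 ltxx.
apply: cvg_lim; first exact: norm_hausdorff.
have c : g n * s^-1 @[n --> \oo] --> 1 * s^-1 by apply: cvgM => //; exact: cvg_cst.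
rewrite mul1r in c; apply: cvg_trans c; apply: near_eq_cvg.
by apply: nearW => n; rewrite -gs mulfK.
Qed.
End qpoch_inf.

(** * Euler's expansions of (-z;p)_oo and 1/(z;p)_oo *)

Lemma expr_neq1 (K : numFieldType) (p : K) :
  `|p| < 1 -> forall n, p ^+ n.+1 != 1.
Proof.
move=> p1 n; apply/eqP => /(congr1 Num.norm); rewrite normr1 normrX => /eqP.
by rewrite lt_eqF// exprn_ilt1.
Qed.

Section euler.
Context {R : realType}.
Local Notation C := R[i].

Lemma norm_complexE (z : C) : exists2 r : R, 0 <= r & `|z| = r%:C.
Proof.
have zE : `|z| = (complex.Re `|z|)%:C by rewrite RRe_real ?normr_real.
by exists (complex.Re `|z|) => //; rewrite -lecR -zE; exact: normr_ge0.
Qed.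

Variable p : C.
Hypothesis p1 : `|p| < 1.

(** By |1 - p^k| >= 1 - |p|^k, the norm of (p;p)_n is at least (r;r)_n with r = |p|, which is
    bounded away from 0. *)
Lemma norm_qpochV_bound :
  exists2 B : C, 0 <= B & forall n, `|(qpoch p p n)^-1| <= B.
Proof.
have [r r0 rE] := norm_complexE p.
have r1 : r < 1 by rewrite -ltcR -rE.
have [|m m0 hm] := @qpoch_lbound R r; first by rewrite r0.
have le_norm n : (qpoch r r n)%:C <= `|qpoch p p n|.
  elim: n => [|n IH]; first by rewrite !qpoch0 normr1.
  rewrite !qpochS rmorphM normrM ler_pM//.
  - by rewrite ler0c ltW// qpoch_gt0// r0.
  - by rewrite ler0c subr_ge0 -exprS exprn_ile1// ltW.
  - by rewrite rmorphB rmorph1 rmorphM rmorphXn /= -rE -normrX -normrM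
      -[X in X - _]normr1 lerB_dist.
exists (m%:C^-1) => [|n]; first by rewrite invr_ge0 ler0c ltW.
have m0' : 0 < m%:C :> C by rewrite (ltcR 0).
have le_m : m%:C <= `|qpoch p p n| by rewrite (le_trans _ (le_norm n))// lecR.
by rewrite normfV lef_pV2// posrE// (lt_le_trans m0').
Qed.

Let qpochp_neq0 : forall n, qpoch p p n != 0 := qpoch_neq0 (expr_neq1 p1).

Lemma norm_gauss_bound (a : C) :
  exists2 B : C, 0 <= B & forall n, `|a ^+ n * p ^+ 'C(n, 2)| <= B.
Proof.
have [r r0 rE] := norm_complexE p; have [b b0 bE] := norm_complexE a.
have [|B B0 hB] := @gauss_bound_real R b r b0; first by rewrite r0 -ltcR -rE.
exists B%:C => [|n]; first by rewrite ler0c.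
by rewrite normrM !normrX rE bE -!rmorphXn -rmorphM lecR.
Qed.

Lemma abs_summable_gauss (z : C) :
  abs_summable (fun n => p ^+ 'C(n, 2) / qpoch p p n * z ^+ n).
Proof.
(* Bounding the Gaussian terms at 2z leaves the summable factor 2^(-n). *)
have [B B0 hB] := norm_gauss_bound (2 * z); have [D D0 hD] := norm_qpochV_bound.
apply: (@abs_summable_le _ _ _ (fun n => (2^-1 : C) ^+ n) (B * D)).
- move=> n; rewrite -[z](mulKf (_ : (2 : C) != 0)) ?pnatr_eq0// exprMn.
  rewrite [X in `|X|](_ : _ =
    (2 * z) ^+ n * p ^+ 'C(n, 2) * (qpoch p p n)^-1 * 2^-1 ^+ n); last by ring.
  by rewrite normrM ler_wpM2r// normrM ler_pM.
- exact: mulr_ge0.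
- by apply: abs_summable_geo; rewrite ger0_norm ?invr_ge0// invf_lt1// ltr1n.
Qed.

Lemma abs_summable_geo_qpoch (z : C) : `|z| < 1 ->
  abs_summable (fun n => (qpoch p p n)^-1 * z ^+ n).
Proof.
move=> z1; have [D D0 hD] := norm_qpochV_bound.
apply: (@abs_summable_le _ _ _ (fun n => z ^+ n) D) => //.
  by move=> n; rewrite normrM ler_wpM2r.
exact: abs_summable_geo.
Qed.

Lemma has_sum_delta (a : C) : has_sum (fun n : nat => if n == 0%N then a else 0) a.
Proof.
apply/has_sumP => e e0; exists [fset 0%N]%fset => B; rewrite fsub1set => B0.
rewrite -big_mkcond -big_filter.
by rewrite (filter_pred1_uniq (fset_uniq B) B0) big_seq1 subrr normr0.
Qed.

Section qdilation.
Variables (u : nat -> C) (z : C) (f : nat -> C).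
Hypothesis u_sum : abs_summable (fun n => u n * z ^+ n).
Hypothesis f_sum : forall k, has_sum (fun n => u n * (z * p ^+ k) ^+ n) (f k).

(** In the series at z p^k every term with n > 0 carries p^(kn), of norm at most |p|^k; hence |f k -
    u 0| <= |p|^k M. *)
Lemma cvg_qdilation (e : C) : 0 < e ->
  exists N, forall n, (N <= n)%N -> `|f n - u 0%N| < e.
Proof.
move=> e0; have [M hM] := u_sum.
have M0 : 0 <= M by have := hM fset0; rewrite big_nil.
have le_f k : `|f k - u 0%N| <= `|p| ^+ k * M.
  refine (has_sum_norm_le (has_sumD (@f_sum k) (has_sum_delta (a := - u 0%N))) _).
  move=> A; rewrite (le_trans _ (ler_wpM2l (exprn_ge0 k (normr_ge0 p)) (hM A)))//.
  rewrite mulr_sumr; apply: ler_sum => -[|n] _ /=.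
    by rewrite !expr0 mulr1 subrr normr0 mulr_ge0// exprn_ge0.
  rewrite addr0 exprMn mulrA normrM mulrC ler_wpM2r// normrX normrX -exprM.
  by rewrite mulnS exprD ler_piMr ?exprn_ge0// exprn_ile1// ltW.
have [r r0 rE] := norm_complexE p; have [m m0 mE] := norm_complexE M.
have [e' e'0 eE] := gt0_real_complex e0.
have [||k hk] := @expr_small R r (e' / (m + 1)).
- by rewrite r0 -ltcR -rE.
- by rewrite divr_gt0// ltr_wpDl.
exists k => j kj; rewrite (le_lt_trans (le_f j))//.
rewrite -(ger0_norm M0) mE rE eE -rmorphXn -rmorphM ltcR.
move: hk; rewrite ltr_pdivlMr ?ltr_wpDl//; apply: le_lt_trans.
rewrite ler_pM ?exprn_ge0 ?lerDl//.
by rewrite ler_wiXn2l// ltW// -ltcR -rE.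
Qed.
End qdilation.

(** From u(n+1) (1 - p^(n+1)) = p^n u(n) follows f(w) = (1 + w) f(wp). Iteration gives (-z;p)_k f(z
    p^k) = f(z), and f(z p^k) tends to u(0) = 1. *)
Theorem euler_qpoch_inf (z : C) :
  has_sum (fun n => p ^+ 'C(n, 2) / qpoch p p n * z ^+ n) (qpoch_inf (- z) p).
Proof.
pose u n := p ^+ 'C(n, 2) / qpoch p p n.
have sum_w w : exists s, has_sum (fun n => u n * w ^+ n) s.
  exact: abs_summable_has_sum (abs_summable_gauss w).
have [f f_sum] := choice sum_w.
have f_rec w : f w = (1 + w) * f (w * p).
  rewrite mulrDl mul1r; apply: (has_sum_unique (f_sum w)).
  have h : has_sum (fun n => u n * (1 - p ^+ n) * w ^+ n) (w * f (w * p)).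
    apply: has_sum_shift; first by rewrite expr0 subrr mulr0 mul0r.
    have := has_sumZ (a := w) (f_sum (w * p)); congr (has_sum _ _).
    apply/funext => n; rewrite /u qpochS exprMn binS bin1 exprD -(exprS p) (exprS w).
    have := qpochp_neq0 n.+1; rewrite qpochS -exprS mulf_eq0 negb_or => /andP[h1 h2].
    by field; rewrite h1 h2.
  have := has_sumD (f_sum (w * p)) h; congr (has_sum _ _).
  by apply/funext => n; rewrite exprMn; ring.
rewrite (@qpoch_inf_eq _ _ _ (fun k => f (z * p ^+ k)) (f z)) //.
- move=> e; rewrite (_ : 1 = u 0%N); last by rewrite /u qpoch0 expr0 divr1.
  exact: (cvg_qdilation (abs_summable_gauss z)).
- elim=> [|k IH]; first by rewrite qpoch0 mul1r expr0 mulr1.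
  by rewrite -IH qpochS [in RHS]f_rec mulNr opprK -(mulrA z) -exprSr mulrA.
Qed.

(** Now u(n+1) (1 - p^(n+1)) = u(n), so the value at wp is 1 - w times the value at w. Summability
    requires |w| < 1, so [f] is indexed by k along the orbit z p^k. *)
Theorem euler_qpoch_infV (z : C) : `|z| < 1 ->
  has_sum (fun n => (qpoch p p n)^-1 * z ^+ n) (qpoch_inf z p)^-1.
Proof.
move=> z1; pose u n := (qpoch p p n)^-1.
have norm_zX k : `|z * p ^+ k| < 1.
  by rewrite normrM normrX (le_lt_trans _ z1)// ler_piMr// exprn_ile1// ltW.
have sum_k k : exists s, has_sum (fun n => u n * (z * p ^+ k) ^+ n) s.
  exact: abs_summable_has_sum (abs_summable_geo_qpoch (norm_zX k)).
have [f f_sum] := choice sum_k.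
have f_rec k : (1 - z * p ^+ k) * f k = f k.+1.
  pose w := z * p ^+ k.
  have h : has_sum (fun n => u n * (1 - p ^+ n) * w ^+ n) (w * f k).
    apply: has_sum_shift; first by rewrite expr0 subrr mulr0 mul0r.
    have := has_sumZ (a := w) (f_sum k); congr (has_sum _ _).
    apply/funext => n; rewrite /u qpochS -/w.
    have := qpochp_neq0 n.+1; rewrite qpochS mulf_eq0 negb_or => /andP[h1 h2].
    rewrite !exprS; field; by rewrite h1 h2.
  apply: (has_sum_unique _ (f_sum k.+1)).
  have := has_sumD (f_sum k) (has_sumZ (a := -1) h).
  rewrite mulrBl mul1r mulN1r; congr (has_sum _ _).
  have zS : z * p ^+ k.+1 = w * p by rewrite /w exprSr mulrA.
  by apply/funext => n; rewrite zS -/w [(w * p) ^+ n]exprMn; ring.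
rewrite (@qpoch_inf_eqV _ _ _ f (f 0%N)).
- by rewrite invrK; have := f_sum 0%N; rewrite expr0 mulr1.
- move=> e; rewrite (_ : 1 = u 0%N); last by rewrite /u qpoch0 invr1.
  exact: (cvg_qdilation (abs_summable_geo_qpoch z1)).
- elim=> [|k IH]; first by rewrite qpoch0 mul1r.
  by rewrite -f_rec -IH qpochS; ring.
Qed.

End euler.

(** * The two triple sums, grouped by the exponents of c and d *)

Lemma binz2 (n : nat) : 'C(n, 2)%:Z * 2 = n%:Z * (n%:Z - 1).
Proof. by elim: n => // n IH; rewrite binS bin1 PoszD mulrDl IH; lia. Qed.

Section multisum.
Context {R : realType}.
Local Notation C := R[i].

Lemma has_sum_prod (I J : choiceType) (i0 : I) (j0 : J) (x : I -> C) (y : J -> C) s t :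
  abs_summable x -> abs_summable y -> has_sum x s -> has_sum y t ->
  has_sum (fun ij : I * J => x ij.1 * y ij.2) (s * t).
Proof.
move=> ax ay hx hy; have [u hu] := abs_summable_has_sum (abs_summable_prod ax ay).
by rewrite -(has_sum_prod_eq i0 j0 hx hy hu).
Qed.

Variables q c d : C.
Hypotheses (q0 : q != 0) (q1 : `|q| < 1) (c0 : c != 0) (d1 : `|d| < 1).

Let q21 : `|q ^+ 2| < 1.
Proof. by rewrite normrX exprn_ilt1. Qed.

Let qpochq_neq0 : forall n, qpoch q q n != 0 := qpoch_neq0 (expr_neq1 q1).

Let qpochq2_neq0 : forall n, qpoch (q ^+ 2) (q ^+ 2) n != 0 :=
  qpoch_neq0 (expr_neq1 q21).

(* The integer [e] stands for m(m - 1)/2. *)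
Lemma norm_gauss_boundz (a : C) : a != 0 ->
  exists2 B : C, 0 <= B &
    forall m e : int, e * 2 = m * (m - 1) -> `|a ^ m * q ^ e| <= B.
Proof.
move=> a0; have [B B0 hB] := norm_gauss_bound q1 a.
(* For m = -(n+1) one has m(m-1)/2 = C(n+1,2) + n+1, so a^m q^e is a Gaussian term in q/a. *)
have [B' B'0 hB'] := norm_gauss_bound q1 (q / a).
exists (B + B') => [|m e]; first exact: addr_ge0.
case: (intP m) => [|n|n] em.
- have -> : e = 0 by lia.
  by rewrite expr0z (le_trans (hB 0%N))// lerDl.
- have -> : e = 'C(n.+1, 2)%:Z by have := binz2 n.+1; lia.
  by rewrite -!exprnP (le_trans (hB _))// lerDl.
- have -> : e = ('C(n.+1, 2) + n.+1)%N%:Z by rewrite PoszD; have := binz2 n.+1; lia.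
  rewrite -exprnN -exprnP exprD (le_trans _ (_ : B' <= _)) ?lerDr//.
  have -> : a ^- n.+1 * (q ^+ 'C(n.+1, 2) * q ^+ n.+1) =
      (q / a) ^+ n.+1 * q ^+ 'C(n.+1, 2).
    by rewrite exprMn exprVn; ring.
  exact: hB'.
Qed.

Definition lterm (i j k : nat) : C :=
  (-1) ^+ i * c ^ (2 * i%:Z - j%:Z + 2 * k%:Z) * d ^+ j * q ^ (qexp i j k)
       / (qpoch q q i * qpoch q q j * qpoch (q ^+ 2) (q ^+ 2) k).

Lemma abs_summable_lterm :
  abs_summable (fun t : nat * nat * nat => lterm t.1.1 t.1.2 t.2).
Proof.
(* With v < 1, |d| <= v ^ 2 and m = i - j + 2k, the identity v^j = v^(i - m + 2k)
   trades half of the decay in j for decay in k, at the cost of a factor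
   v^(i - m) that the Gaussian powers of q absorb. *)
have [r r0 rE] := norm_complexE d.
(* By the inequality of arithmetic and geometric means w^2 >= r = |d|; moreover 0 < w < 1, even when
   d = 0. *)
pose w : R := (1 + r) / 2; pose v : C := w%:C.
have r1 : r < 1 by rewrite -ltcR -rE.
have w0 : 0 < w by rewrite /w; lra.
have w1 : w < 1 by rewrite /w; lra.
have v0 : v != 0 by rewrite /v fmorph_eq0 gt_eqF.
have rw : r <= w ^+ 2 by rewrite /w; nra.
have nv : `|v| < 1 by rewrite norm_real_complex ltcR gtr0_norm.
have dv : `|d / v ^+ 2| <= 1.
  rewrite normrM rE normfV normrX norm_real_complex gtr0_norm//.
  rewrite -rmorphXn -fmorphV -rmorphM.
  by rewrite lecR ler_pdivrMr ?exprn_gt0// mul1r.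
(* The factor 2 leaves 2^(-i) as the decay in i of the comparison family. *)
have [B1 B10 hB1] := norm_gauss_bound q1 (2 * c * v).
have [|B2 B20 hB2] := @norm_gauss_boundz (c / v).
  by rewrite mulf_neq0// invr_neq0.
have [D D0 hD] := norm_qpochV_bound q1; have [D2 D20 hD2] := norm_qpochV_bound q21.
have s2 : abs_summable (fun i => (2^-1 : C) ^+ i).
  by apply: abs_summable_geo; rewrite ger0_norm ?invr_ge0// invf_lt1// ltr1n.
have sv : abs_summable (fun k => (v ^+ 2) ^+ k).
  by apply: abs_summable_geo; rewrite normrX exprn_ilt1.
have sy := abs_summable_prod (abs_summable_prod s2 (abs_summable_geo nv)) sv.
apply: (abs_summable_le (C := B1 * B2 * (D * D * D2)) _ _ sy); last by rewrite !mulr_ge0.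
move=> [[i j] k] /=; set y := _ ^+ i * _ * _.
pose m : int := i%:Z - j%:Z + 2 * k%:Z; pose e : int := qexp i j k - 'C(i, 2)%:Z.
have em : e * 2 = m * (m - 1).
  rewrite mulrBl qexp_numE binz2 /qexp_num /m; ring.
have -> : lterm i j k = (-1) ^+ i * ((2 * c * v) ^+ i * q ^+ 'C(i, 2)) *
    ((c / v) ^ m * q ^ e) * (d / v ^+ 2) ^+ j *
    ((qpoch q q i)^-1 * (qpoch q q j)^-1 * (qpoch (q ^+ 2) (q ^+ 2) k)^-1) * y.
  have ce : c ^ (2 * i%:Z - j%:Z + 2 * k%:Z) = c ^+ i * c ^ m.
    by rewrite exprnP -expfzDr//; congr (_ ^ _); rewrite /m; ring.
  have qe : q ^ qexp i j k = q ^+ 'C(i, 2) * q ^ e.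
    by rewrite exprnP -expfzDr//; congr (_ ^ _); rewrite /e; ring.
  have vm : (c / v) ^ m = c ^ m * v ^+ j / (v ^+ i * (v ^+ 2) ^+ k).
    rewrite expfzMl -expfV -mulrA; congr (_ * _).
    rewrite -exprM /m !expfzDr// mulnC -exprnP -(exprnP _ (2 * k)).
    by rewrite -exprnN (mulnC k) !invfM invrK; ring.
  rewrite /lterm ce qe vm /y (expr2 v) !exprMn !exprVn !exprMn.
  by field; rewrite ?qpochq_neq0 ?qpochq2_neq0//= !expf_neq0// pnatr_eq0.
rewrite normrM ler_wpM2r//.
rewrite normrM ler_pM ?mulr_ge0//; last first.
  by rewrite !normrM !ler_pM ?mulr_ge0.
rewrite normrM -[leRHS]mulr1 ler_pM//; last by rewrite normrX exprn_ile1.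
rewrite normrM ler_pM//; last by apply: hB2.
by rewrite normrM normrX normrN normr1 expr1n mul1r.
Qed.

(** With a = i + 2k, (a-j)(a-j-1)/2 = C(a,2) - a j + C(j+1,2); for fixed N, i and j thus interact
    only through (q^-j)^a, the power of x in [lser]. *)
Lemma lterm_lser N i j : (i <= N)%N ->
  lterm i j (N - i) =
  c ^ (2 * N%:Z - j%:Z) * d ^+ j * q ^+ 'C(j.+1, 2) / qpoch q q j *
    (lser_coef q i (N - i) * (q ^- j) ^+ (i + 2 * (N - i))).
Proof.
move=> iN; rewrite /lterm /lser_coef; set k := (N - i)%N.
have -> : 2 * i%:Z - j%:Z + 2 * k%:Z = 2 * N%:Z - j%:Z by rewrite /k; lia.
have -> : qexp i j k =
    ('C(i, 2) + 'C(i + 2 * k, 2) + 'C(j.+1, 2))%N%:Z - (j * (i + 2 * k))%N%:Z.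
  apply: (@mulIf _ (2 : int)) => //.
  rewrite mulrBl 2!PoszD 2!mulrDl qexp_numE !binz2.
  rewrite /qexp_num (intS j) !PoszM (PoszD i) PoszM.
  by ring.
have -> (A B : nat) : q ^ (A%:Z - B%:Z) = q ^+ A / q ^+ B.
  by rewrite expfzDr// -exprnN -exprnP.
rewrite (exprD q _ 'C(j.+1, 2)) (exprM q j) exprVn.
set e := q ^+ j ^+ _; have e0 : e != 0 by rewrite !expf_neq0.
by field; rewrite ?qpochq_neq0 ?qpochq2_neq0// e0.
Qed.

(** Product of the general terms of Euler's expansions of (-dq/c;q)_oo, (c^2;q^2)_oo and
    1/(d^2;q^2)_oo. *)
Definition rterm (r n s : nat) : C :=
  q ^+ 'C(r, 2) / qpoch q q r * (d * q / c) ^+ r *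
  ((q ^+ 2) ^+ 'C(n, 2) / qpoch (q ^+ 2) (q ^+ 2) n * (- c ^+ 2) ^+ n) *
  ((qpoch (q ^+ 2) (q ^+ 2) s)^-1 * (d ^+ 2) ^+ s).

(** With r = j - 2s, [qpoch_invq] at m = 2s, where the sign is 1, trades 1/(q;q)_r for
    (q^-j;q)_(2s); its power q^C(r+1,2) is q^C(r,2) from Euler's expansion times q^r from
    (dq/c)^r. *)
Lemma rterm_rser N j s : (s <= N)%N -> (2 * s <= j)%N ->
  rterm (j - 2 * s) (N - s) s =
  c ^ (2 * N%:Z - j%:Z) * d ^+ j * q ^+ 'C(j.+1, 2) / qpoch q q j *
    (rser_coef q (N - s) s * qpoch (q ^- j) q (2 * s)).
Proof.
move=> sN sj; rewrite /rterm /rser_coef.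
have := qpoch_invq q0 sj; rewrite exprM sqrrN expr1n expr1n mul1r.
have := qpochq_neq0 (j - 2 * s).
have := subnKC sj; have := subnKC sN.
set n := (N - s)%N; set r := (j - 2 * s)%N => nE rE Pr0 invq.
have -> : c ^ (2 * N%:Z - j%:Z) = c ^+ 2 ^+ n / c ^+ r.
  rewrite [2 * _ - _](_ : _ = (2 * n)%N%:Z - r%:Z); last by lia.
  by rewrite expfzDr// -exprnN -exprnP exprM.
have -> : d ^+ j = d ^+ r * d ^+ 2 ^+ s by rewrite -exprM -exprD addnC rE.
have -> : (- c ^+ 2) ^+ n = (-1) ^+ n * c ^+ 2 ^+ n by rewrite -exprMn mulN1r.
rewrite (binS r) bin1 exprD in invq.
have -> : qpoch (q ^- j) q (2 * s) =
    q ^+ 'C(r, 2) * q ^+ r * qpoch q q j / (q ^+ 'C(j.+1, 2) * qpoch q q r).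
  by rewrite -invq; field; rewrite Pr0 expf_neq0.
rewrite !exprMn exprVn.
by field; rewrite ?qpochq_neq0 ?qpochq2_neq0// !expf_neq0.
Qed.

(** The pair t = (N, j) marks the monomial c^(2N-j) d^j; [lfiber] and [rfiber] list the finitely
    many triples contributing to it on each side. *)
Definition lfiber (t : nat * nat) : seq (nat * nat * nat) :=
  [seq (i, t.2, (t.1 - i)%N) | i <- iota 0 t.1.+1].

Definition rfiber (t : nat * nat) : seq (nat * nat * nat) :=
  [seq ((t.2 - 2 * s)%N, (t.1 - s)%N, s) | s <- iota 0 t.1.+1 & (2 * s <= t.2)%N].

Lemma lfiber_uniq t : uniq (lfiber t).
Proof. by rewrite map_inj_uniq ?iota_uniq// => i j []. Qed.

Lemma rfiber_uniq t : uniq (rfiber t).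
Proof. by rewrite map_inj_uniq ?filter_uniq ?iota_uniq// => i j []. Qed.

Lemma mem_lfiber x t : (x \in lfiber t) = ((x.1.1 + x.2, x.1.2)%N == t).
Proof.
case: x t => [[i j] k] [N j']; apply/mapP/eqP => [[l]|[<- <-]].
  by rewrite mem_iota /= => ? [-> -> ->]; congr (_, _); lia.
by exists i; rewrite ?mem_iota /=; [lia|congr (_, _, _); lia].
Qed.

Lemma mem_rfiber x t : (x \in rfiber t) = ((x.1.2 + x.2, x.1.1 + 2 * x.2)%N == t).
Proof.
case: x t => [[r n] s] [N j]; apply/mapP/eqP => [[l]|[<- <-]].
  by rewrite mem_filter mem_iota /= => ? [-> -> ->]; congr (_, _); lia.
by exists s; rewrite ?mem_filter ?mem_iota /=; [lia|congr (_, _, _); lia].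
Qed.

(** Both sides are one common factor times [lser] and [rser] at q^-j; the terms of [rser] with 2s >
    j, absent from [rfiber], vanish there. *)
Lemma fiber_sum_eq t :
  \sum_(x <- lfiber t) lterm x.1.1 x.1.2 x.2 = \sum_(x <- rfiber t) rterm x.1.1 x.1.2 x.2.
Proof.
set N := t.1; set j := t.2.
rewrite !big_map big_filter -[iota 0 N.+1]/(index_iota 0 N.+1) !big_mkord /=.
rewrite (eq_bigr _ (fun i _ => lterm_lser j (leq_ord i))) -mulr_sumr.
rewrite -/(lser q N (q ^- j)) (lser_rser q0 (expr_neq1 q1)) mulr_sumr [RHS]big_mkcond /=.
apply: eq_bigr => s _; case: leqP => sj; first by rewrite rterm_rser// leq_ord.
by rewrite qpoch_invq_gt// !mulr0.
Qed.

Lemma has_sum_lterm :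
  has_sum (fun t : nat * nat * nat => lterm t.1.1 t.1.2 t.2)
    (qpoch_inf (- d * q / c) q * qpoch_inf (c ^+ 2) (q ^+ 2)
     / qpoch_inf (d ^+ 2) (q ^+ 2)).
Proof.
have d21 : `|d ^+ 2| < 1 by rewrite normrX exprn_ilt1.
have ar := abs_summable_gauss q1 (d * q / c).
have an := abs_summable_gauss q21 (- c ^+ 2).
have ak := abs_summable_geo_qpoch q21 d21.
have hr := euler_qpoch_inf q1 (z := d * q / c).
have hn := euler_qpoch_inf q21 (z := - c ^+ 2).
have hs := euler_qpoch_infV q21 d21.
have hrn := has_sum_prod 0%N 0%N ar an hr hn.
have := has_sum_prod (0, 0)%N 0%N (abs_summable_prod ar an) ak hrn hs.
move=> /(has_sum_fiber rfiber_uniq mem_rfiber) hR.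
have -> : - d * q / c = - (d * q / c) by rewrite !mulNr.
rewrite -[c ^+ 2]opprK.
(* Absolute summability gives the left sum some value u; regrouping over (N, j), where the fibre
   sums agree, identifies u with the product. *)
have [u hu] := abs_summable_has_sum abs_summable_lterm.
have hL := has_sum_fiber lfiber_uniq mem_lfiber hu.
rewrite (funext fiber_sum_eq) in hL.
by rewrite -(has_sum_unique hL hR).
Qed.
End multisum.

Unset Implicit Arguments.

Theorem theorem4p4 (R : realType) (q c d : R[i])
    (hq : 0 < `|q| < 1) (hc : c != 0) (hd : `|d| < 1) :
  has_sum
    (fun ijk : nat * nat * nat =>
       let: (i, j, k) := ijk in
       (-1) ^+ i * c ^ (2 * i%:Z - j%:Z + 2 * k%:Z) * d ^+ j * q ^ (qexp i j k)
       / (qpoch q q i * qpoch q q j * qpoch (q ^+ 2) (q ^+ 2) k))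
    (qpoch_inf (- d * q / c) q * qpoch_inf (c ^+ 2) (q ^+ 2)
     / qpoch_inf (d ^+ 2) (q ^+ 2)).
Proof.
have /andP[q0 q1] := hq; rewrite normr_gt0 in q0.
have := has_sum_lterm q0 q1 hc hd; congr (has_sum _ _).
by apply/funext => -[[i j] k].
Qed.
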